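(* Let $N=2n\geq4$ be even, $\omega=\exp(2\pi i/N)$, and let $u\in\mathbb{C}$ with $u\neq0$, $u^N\neq1$. For $\boldsymbol k=(k_1,\ldots,k_{n-1})\in\mathbb{Z}^{n-1}$ put $$C_N(\boldsymbol k)=\prod_{j=1}^{n-1}\bigl(\omega^{jk_j}-\omega^{-jk_j}\bigr),\qquad \mathcal{W}_{N,n-1}(\boldsymbol k;u)=\Lambda T^{k_1}\Lambda\cdots T^{k_{n-1}}\Lambda .$$ Then $$\mathcal{W}_{N,n-1}(\boldsymbol k;u)\neq0\iff C_N(\boldsymbol k)\neq0\iff n\nmid jk_j\quad\text{for all }1\leq j<n .$$ Every nonzero such word has rank two. The vector $v_N=ax^{n-1}\in\mathcal R$ satisfies $$B_{k_1}\cdots B_{k_{n-1}}\,s\,v_N=C_N(\boldsymbol k)\cdot 1 .$$ Finally, among the $N^{n-1}$ exponent tuples $\boldsymbol k$ modulo $N=2n$, exactly $$2^{n-1}\prod_{j=1}^{n-1}\bigl(n-\gcd(j,n)\bigr)$$ give nonzero words $\mathcal{W}_{N,n-1}(\boldsymbol k;u)$.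
   Context: Index the standard basis of $\mathbb{C}^N$ by $j\in\mathbb{Z}/N\mathbb{Z}$ (writing $\epsilon_j$) and define $t\epsilon_j=\epsilon_{j-1}$, $d\epsilon_j=\omega^j\epsilon_j$. For $u\neq0$, $u^N\neq1$, the operator $a=ud-u^{-1}d^{-1}$ is invertible; put $s=a^{-1}$ and, on $\mathbb{C}^{2N}=\mathbb{C}^N\oplus\mathbb{C}^N$, $$T=\begin{pmatrix}t&0\\0&t^{-1}\end{pmatrix},\qquad \Lambda=\begin{pmatrix}s&s\\-s&-s\end{pmatrix}.$$ Since $T^N=\mathrm{I}$, words depend only on the exponents modulo $N$. Cyclic model: $\mathcal R=\mathbb{C}[z,z^{-1}]/(z^N-1)$ is identified with $\mathbb{C}^N$ by evaluation $f\mapsto(f(\omega^j))_j$. Under this identification $d$ is multiplication by $z$, $(tf)(z)=f(\omega z)$, $a$ is (multiplication by) $uz-u^{-1}z^{-1}$, a unit of $\mathcal R$, and $s$ is multiplication by $a^{-1}$. Put $x=uz+u^{-1}z^{-1}\in\mathcal R$, and for $k\in\mathbb{Z}$ let $B_k=s(t^k-t^{-k})$, an operator on $\mathcal R$. *)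

(* Defs.v *)
From mathcomp Require Import all_boot all_order all_algebra.
From mathcomp Require Import all_classical all_reals all_analysis.
From mathcomp Require Import complex.

Set Implicit Arguments.
Unset Strict Implicit.
Unset Printing Implicit Defensive.

Import Order.TTheory GRing.Theory Num.Theory.

Local Open Scope ring_scope.
Local Open Scope complex_scope.

(* omega = exp (2 pi i / N), written in real and imaginary parts *)
Definition omega (R : realType) (N : nat) : R[i] :=
  cos (2 * pi / N%:R) +i* sin (2 * pi / N%:R).

(* Operators on C^N are N x N matrices acting on column vectors; the index    *)
(* set Z/NZ is 'I_N, and [ord_pred j] is the residue class of j - 1.          *)
Definition t_mx (R : realType) (N : nat) : 'M[R[i]]_N :=
  \matrix_(i, j) (i == ord_pred j)%:R.

Definition d_mx (R : realType) (N : nat) : 'M[R[i]]_N :=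
  diag_mx (\row_j omega R N ^+ j).

Definition a_mx (R : realType) (N : nat) (u : R[i]) : 'M[R[i]]_N :=
  u *: d_mx R N - u^-1 *: invmx (d_mx R N).

Definition s_mx (R : realType) (N : nat) (u : R[i]) : 'M[R[i]]_N :=
  invmx (a_mx N u).

Definition T_mx (R : realType) (N : nat) : 'M[R[i]]_(N + N) :=
  block_mx (t_mx R N) 0 0 (invmx (t_mx R N)).

Definition Lambda_mx (R : realType) (N : nat) (u : R[i]) : 'M[R[i]]_(N + N) :=
  block_mx (s_mx N u) (s_mx N u) (- s_mx N u) (- s_mx N u).

(* Integer powers of an invertible matrix of arbitrary size: the library's    *)
(* [_ ^ _] needs a [unitRingType], hence a size that is a successor.          *)
Definition mxpowz (F : fieldType) (m : nat) (A : 'M[F]_m) (k : int) : 'M[F]_m :=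
  match k with
  | Posz p => A ^+ p
  | Negz p => invmx A ^+ p.+1
  end.

(* Exponent tuples are 0-based here: [k i] is k_{i+1}. *)
Definition word (R : realType) (N m : nat) (k : 'I_m -> int) (u : R[i]) :
    'M[R[i]]_(N + N) :=
  Lambda_mx N u *m \prod_(i < m) (mxpowz (T_mx R N) (k i) *m Lambda_mx N u).

Definition C_prod (R : realType) (N m : nat) (k : 'I_m -> int) : R[i] :=
  \prod_(i < m) (omega R N ^ (i.+1%:Z * k i) - omega R N ^ (- (i.+1%:Z * k i))).

(* C[z, z^-1] / (z^N - 1): in C[z] / (z^N - 1) the class z of 'X is already   *)
(* invertible, with inverse z^(N-1), so no Laurent polynomials are needed.    *)
(* The modulus is monic of size > 1, as [qpoly] requires, when N > 0.         *)
Definition cyc (R : realType) (N : nat) := {poly %/ ('X^N - 1 : {poly R[i]})}.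

Definition cyc_z (R : realType) (N : nat) : cyc R N := 'qX.

Definition cyc_a (R : realType) (N : nat) (u : R[i]) : cyc R N :=
  u *: cyc_z R N - u^-1 *: (cyc_z R N)^-1.

Definition cyc_x (R : realType) (N : nat) (u : R[i]) : cyc R N :=
  u *: cyc_z R N + u^-1 *: (cyc_z R N)^-1.

Definition cyc_subst (R : realType) (N : nat) (c : R[i]) (f : cyc R N) :
    cyc R N :=
  in_qpoly ('X^N - 1) ((f : {poly R[i]}) \Po (c *: 'X)).

Definition cyc_t (R : realType) (N : nat) : cyc R N -> cyc R N :=
  cyc_subst (omega R N).

Definition cyc_tV (R : realType) (N : nat) : cyc R N -> cyc R N :=
  cyc_subst (omega R N)^-1.

Definition cyc_tz (R : realType) (N : nat) (k : int) : cyc R N -> cyc R N :=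
  match k with
  | Posz p => iter p (@cyc_t R N)
  | Negz p => iter p.+1 (@cyc_tV R N)
  end.

Definition cyc_s (R : realType) (N : nat) (u : R[i]) (f : cyc R N) : cyc R N :=
  (cyc_a N u)^-1 * f.

Definition cyc_B (R : realType) (N : nat) (u : R[i]) (k : int) (f : cyc R N) :
    cyc R N :=
  cyc_s u (cyc_tz k f - cyc_tz (- k) f).

(* Main.v *)
(* Since Lambda = (1, -1)^T s (1, 1), a word factors through the operator     *)
(* B_{k_1} ... B_{k_{n-1}} s on C^N and has the same rank; s is invertible.   *)
(* Write y = u z, so that t^k y^m = omega^{km} y^m and y^N = u^N. Then B_k    *)
(* maps y^e (y^m + y^-m), for e = 0 or n, to                                  *)
(* omega^{ke} (omega^{km} - omega^{-km}) y^e U_{m-1}(x), with U_m the         *)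
(* Chebyshev polynomials of the second kind and x = y + y^-1: B_k lowers the  *)
(* degree by one on each of the chains y^e C[x]_{< n}. Because u^N <> 1 the   *)
(* two chains together span C^N, so B_{k_1} ... B_{k_{n-1}} kills everything  *)
(* but the two top-degree vectors, which it sends to C_N(k) times, up to      *)
(* sign, the independent vectors 1 and y^n. Hence the rank is 2 or 0          *)
(* according to whether C_N(k) vanishes, and the chain e = 0 gives the        *)
(* formula for v_N.                                                           *)

Require Import Defs.
From mathcomp Require Import all_boot all_order all_algebra.
From mathcomp Require Import all_classical all_reals all_analysis.
From mathcomp Require Import perm complex.
From mathcomp Require Import zify ring lra.

Set Implicit Arguments.
Unset Strict Implicit.
Unset Printing Implicit Defensive.

Import Order.TTheory GRing.Theory Num.Theory.

Local Open Scope ring_scope.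
Local Open Scope complex_scope.

(** Evaluation at the N-th roots of unity turns all operators into N x N matrices. [word_factor] and
    [mxrank_word] trade a word for the product [reduced_word] of the operators B_k. With y = u z,
    each B_k lowers the degree by one, modulo lower terms, on the chains y^e U_m(y + y^-1) with e =
    0 or n ([B_mx_chebS]). Hence n-1 of them kill everything below the top degree, where the scalars
    multiply to C_N(k) times a power of omega ([reduced_word_cheb]). The two chains span C^N
    ([cheb_span]) and 1, y^n are independent ([monom_free]), so the rank is 2 or 0
    ([mxrank_word_C]). For v_N, s cancels a, and x^{n-1} agrees with U_{n-1}(x) modulo lower terms
    ([cyc_B_x]). For the count, C_N(k) != 0 is a separate condition on each k_j, with 2(n -
    gcd(j,n)) solutions modulo 2n ([card_ord_ndvd_mul]). *)

Lemma omegaX (R : realType) (N m : nat) :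
  omega R N ^+ m =
  cos (m%:R * (2 * pi / N%:R)) +i* sin (m%:R * (2 * pi / N%:R)).
Proof.
elim: m => [|m IHm]; first by rewrite expr0 mul0r cos0 sin0.
rewrite exprS IHm /omega; set th := 2 * pi / N%:R.
rewrite -nat1r mulrDl mul1r cosD sinD.
by apply/eqP; rewrite eq_complex /= eqxx addrC eqxx.
Qed.

(** Half-angle formula: 1 - cos x = 2 sin(x/2)^2, and sin is positive on (0, pi). *)
Lemma cos_lt1 (R : realType) (x : R) : 0 < x < 2 * pi -> cos x < 1.
Proof.
move=> x_in; have -> : x = (x / 2) *+ 2 by rewrite mulr2n; lra.
rewrite cos_mulr2n cos2sin2.
have sin_gt0 : 0 < sin (x / 2) by apply: sin_gt0_pi; lra.
by have := exprn_gt0 2 sin_gt0; lra.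
Qed.

Lemma omega_prim (R : realType) (N : nat) :
  (0 < N)%N -> N.-primitive_root (omega R N).
Proof.
move=> N_gt0; have N_gt0R : 0 < N%:R :> R by rewrite ltr0n.
have pi_gt0 := pi_gt0 R.
rewrite /primitive_root_of_unity N_gt0; apply/forallP => i; apply/eqP.
rewrite unity_rootE omegaX.
case: (eqVneq i.+1 N) => [->|iN].
  have -> : N%:R * (2 * pi / N%:R) = pi *+ 2 :> R.
    by rewrite mulrC divfK ?gt_eqF // mulr_natl.
  by rewrite cos2pi sin2pi eqxx.
apply/negbTE/eqP => -[cos1 _].
have lt_iN : (i.+1 < N)%N by rewrite ltn_neqAle iN ltn_ord.
have : 0 < i.+1%:R * (2 * pi / N%:R : R) < 2 * pi.
  apply/andP; split; first by rewrite !mulr_gt0 ?invr_gt0 ?ltr0n.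
  rewrite mulrA ltr_pdivrMr // [X in _ < X]mulrC ltr_pM2r ?ltr_nat //.
  by rewrite mulr_gt0.
by move=> /cos_lt1; rewrite cos1 ltxx.
Qed.

(** * Words as N x N matrices *)

Section WordReduction.

Variables (R : realType) (N : nat) (u : R[i]).

Lemma t_mxE : t_mx R N = perm_mx (perm (@ordS_inj N)).
Proof.
apply/matrixP=> i j; rewrite !mxE permE.
by rewrite -(inj_eq (@ordS_inj N)) ord_predK.
Qed.

Lemma t_mx_unit : t_mx R N \in unitmx.
Proof. by rewrite t_mxE unitmx_perm. Qed.

Lemma invmx_eq (F : fieldType) m (A B : 'M[F]_m) : A *m B = 1%:M -> invmx A = B.
Proof.
move=> AB1; have [Au _] := mulmx1_unit AB1.
by rewrite -[LHS]mulmx1 -AB1 mulKmx.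
Qed.

Lemma mxpowz_eigen (F : fieldType) m (A : 'M[F]_m) (v : 'cV_m) c k :
  A \in unitmx -> c != 0 -> A *m v = c *: v -> mxpowz A k *m v = c ^ k *: v.
Proof.
move=> Au c_neq0 Av.
have powP (B : 'M[F]_m) b p : B *m v = b *: v -> (B ^+ p) *m v = b ^+ p *: v.
  move=> Bv; elim: p => [|p IHp]; first by rewrite !expr0 mul1mx scale1r.
  by rewrite exprSr -mulmxA Bv -scalemxAr IHp scalerA -exprS.
case: k => p; first exact: powP.
rewrite /= NegzE -exprz_inv; apply: powP; rewrite -[LHS]scale1r -(mulVf c_neq0).
by rewrite -scalerA scalemxAr -Av mulKmx.
Qed.

Lemma T_mx_powz k :
  mxpowz (T_mx R N) k =
  block_mx (mxpowz (t_mx R N) k) 0 0 (mxpowz (t_mx R N) (- k)).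
Proof.
have blockX (A B : 'M[R[i]]_N) p :
    (block_mx A 0 0 B) ^+ p = block_mx (A ^+ p) 0 0 (B ^+ p).
  elim: p => [|p IHp]; first by rewrite !expr0 -scalar_mx_block.
  by rewrite !exprS IHp -!mulmxE mulmx_block !(mulmx0, mul0mx, addr0, add0r).
have invT : invmx (T_mx R N) = block_mx (invmx (t_mx R N)) 0 0 (t_mx R N).
  apply: invmx_eq; rewrite mulmx_block !(mulmx0, mul0mx, addr0, add0r).
  by rewrite mulmxV ?mulVmx ?t_mx_unit // -scalar_mx_block.
case: k => p /=; last by rewrite invT blockX.
by rewrite blockX; case: p.
Qed.

Definition B_mx k : 'M[R[i]]_N :=
  s_mx N u *m (mxpowz (t_mx R N) k - mxpowz (t_mx R N) (- k)).

Definition reduced_word m (k : 'I_m -> int) : 'M[R[i]]_N :=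
  \prod_(i < m) B_mx (k i).

(** Between consecutive factors, (1, 1) T^k (1, -1)^T collapses to t^k - t^-k. With the s on its
    left this is one [B_mx]; the last s is left over. *)
Lemma word_factor m (k : 'I_m -> int) :
  word N k u =
  col_mx 1%:M (- 1%:M) *m (reduced_word k *m s_mx N u) *m row_mx 1%:M 1%:M.
Proof.
rewrite /word /reduced_word /B_mx.
have LambdaE :
    Lambda_mx N u = col_mx 1%:M (- 1%:M) *m s_mx N u *m row_mx 1%:M 1%:M.
  by rewrite mul_col_mx mul_col_row mulNmx !mul1mx !mulmx1.
elim: (index_enum _) => [|i r IHr].
  by rewrite !big_nil mulmx1 mul1mx LambdaE.
have sandwich : row_mx 1%:M 1%:M *m mxpowz (T_mx R N) (k i) *m
    col_mx 1%:M (- 1%:M) = mxpowz (t_mx R N) (k i) - mxpowz (t_mx R N) (- k i).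
  rewrite T_mx_powz mul_row_block mul_row_col.
  by rewrite !(mulmx0, mul0mx, addr0, add0r, mul1mx, mulmxN, mulmx1).
rewrite !big_cons -!mulmxE -mulmxA IHr {1}LambdaE -sandwich.
by rewrite !mulmxA.
Qed.

(** The two outer factors have one-sided inverses, so neither they nor the invertible s change the
    rank. *)
Lemma mxrank_word m (k : 'I_m -> int) :
  s_mx N u \in unitmx -> \rank (word N k u) = \rank (reduced_word k).
Proof.
move=> s_unit; rewrite word_factor; set W := reduced_word k.
rewrite mxrankMfree; last first.
  apply/row_freeP; exists (col_mx 1%:M 0).
  by rewrite mul_row_col mulmx1 mulmx0 addr0.
rewrite -mxrank_tr trmx_mul mxrankMfree; last first.
  apply/row_freeP; exists (col_mx 1%:M 0).
  by rewrite tr_col_mx mul_row_col trmx1 mulmx1 mulmx0 addr0.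
by rewrite mxrank_tr mxrankMfree // row_free_unit.
Qed.

End WordReduction.

(** * Chebyshev chains and the cyclic model *)

Section LaurentBasis.

Variables (R : realType) (N : nat) (u : R[i]).

Local Notation w := (omega R N).
Local Notation C := R[i].

(** The value of y = u z at omega^i; absorbing u gives a = y - y^-1 and x = y + y^-1. *)
Definition node (i : 'I_N) : C := u * w ^+ i.

Definition monom (m : int) : 'cV[C]_N := \col_i node i ^ m.

Lemma t_mx_col (v : 'cV[C]_N) i : (t_mx R N *m v) i 0 = v (ordS i) 0.
Proof. by rewrite t_mxE -row_permE mxE permE. Qed.

Definition omega_sub k : C := w ^ k - w ^ (- k).

Lemma reduced_word_recr m (k : 'I_m.+1 -> int) :
  reduced_word N u k =
  reduced_word N u (fun i => k (widen_ord (leqnSn m) i)) *m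
  B_mx N u (k ord_max).
Proof. by rewrite /reduced_word big_ord_recr. Qed.

(* [cheb e m] is y^e U_m(y + y^-1), with U_m the Chebyshev polynomial of the  *)
(* second kind and y = u z; the two chains on which the operators B_k lower   *)
(* the degree are those with e = 0 and e = n.                                 *)
Definition cheb (e : int) (m : nat) : 'cV[C]_N :=
  \sum_(i < m.+1) monom (e + m%:Z - 2 * i%:Z).

Lemma cheb0 e : cheb e 0 = monom e.
Proof. by rewrite /cheb big_ord_recl big_ord0 addr0 !addr0. Qed.

Lemma cheb1 e : cheb e 1 = monom (e + 1%:Z) + monom (e - 1%:Z).
Proof.
rewrite /cheb !big_ord_recl big_ord0 /= !addr0.
by congr (monom _ + monom _); rewrite /bump /=; lia.
Qed.

Lemma chebSS e m :
  cheb e m.+2 = cheb e m + (monom (e + m.+2%:Z) + monom (e - m.+2%:Z)).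
Proof.
rewrite /cheb big_ord_recl big_ord_recr /= addrCA.
congr (_ + (monom _ + monom _)); [|by lia|by rewrite /bump /=; lia].
by apply: eq_bigr => i _; congr monom; rewrite /bump /=; lia.
Qed.

(* Membership in the span of the [cheb e j] for [j < m], stated dually: this  *)
(* is the only form in which lower-degree terms are ever used.                *)
Definition lower (e : int) (m : nat) (v : 'cV[C]_N) :=
  forall p (M : 'M[C]_(p, N)),
    (forall j, (j < m)%N -> M *m cheb e j = 0) -> M *m v = 0.

(* Evaluation at the N-th roots of unity identifies [cyc R N] with C^N.       *)
Definition cyc_val (i : 'I_N) (f : cyc R N) : C := (f : {poly C}).[w ^+ i].

Lemma cyc_valD i f g : cyc_val i (f + g) = cyc_val i f + cyc_val i g.
Proof. exact: hornerD. Qed.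

Lemma cyc_valB i f g : cyc_val i (f - g) = cyc_val i f - cyc_val i g.
Proof. by rewrite cyc_valD /cyc_val hornerN. Qed.

Lemma cyc_valZ i c f : cyc_val i (c *: f) = c * cyc_val i f.
Proof. exact: hornerZ. Qed.

Lemma cyc_val1 i : cyc_val i 1 = 1.
Proof. exact: hornerC. Qed.

Definition cyc_col (f : cyc R N) : 'cV[C]_N := \col_i cyc_val i f.

Definition x_mx : 'M[C]_N := diag_mx (\row_i (node i + (node i)^-1)).

Hypothesis N_gt0 : (0 < N)%N.

Let w_prim : N.-primitive_root w.
Proof. exact: omega_prim. Qed.

Let w_neq0 : w != 0.
Proof. by rewrite (prim_root_eq0 w_prim) -lt0n. Qed.

Let wN : w ^+ N = 1.
Proof. exact: prim_expr_order. Qed.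

Lemma node_ordS i : node (ordS i) = w * node i.
Proof. by rewrite /node /= (prim_expr_mod w_prim) exprS mulrCA. Qed.

Lemma nodeXN i : node i ^+ N = u ^+ N.
Proof. by rewrite exprMn exprAC wN expr1n mulr1. Qed.

Lemma t_mx_powz_monom k m :
  mxpowz (t_mx R N) k *m monom m = w ^ (k * m) *: monom m.
Proof.
rewrite mulrC -exprz_exp; apply: mxpowz_eigen; first exact: t_mx_unit.
  exact: expfz_neq0.
by apply/colP => i; rewrite t_mx_col !mxE node_ordS expfzMl.
Qed.

Lemma B_mx_monom k m :
  B_mx N u k *m monom m = omega_sub (k * m) *: (s_mx N u *m monom m).
Proof.
rewrite /B_mx -mulmxA mulmxBl !t_mx_powz_monom -scalerBl -scalemxAr.
by rewrite mulNr.
Qed.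

(** As omega^{2e} = 1, t^k and t^-k multiply y^e by the same scalar. *)
Lemma B_mx_cheb0 k (e : int) : w ^ (2 * e) = 1 -> B_mx N u k *m cheb e 0 = 0.
Proof.
move=> w2e; rewrite cheb0 B_mx_monom.
suff -> : omega_sub (k * e) = 0 by rewrite scale0r.
apply/eqP; rewrite subr_eq0; apply/eqP; rewrite -[RHS]mulr1.
have <- : (w ^ (2 * e)) ^ k = 1 by rewrite w2e exp1rz.
by rewrite exprz_exp -expfzDr //; congr (_ ^ _); lia.
Qed.

Lemma omega_expz_eq1 m : (w ^ m == 1) = (N%:Z %| m)%Z.
Proof.
case: m => m; [|rewrite NegzE -invr_expz invr_eq1]; rewrite -exprnP dvdzE.
  by rewrite -(prim_order_dvd w_prim).
by rewrite -(prim_order_dvd w_prim) abszN.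
Qed.

(** * Evaluation on the cyclic model *)

Lemma mk_monic_XnsubC : mk_monic ('X^N - 1 : {poly C}) = 'X^N - 1.
(* [mk_monic] substitutes a default for a modulus that is not monic of size above 1; [N_gt0] rules
   this out. *)
Proof. by rewrite /mk_monic size_XnsubC ?monicXnsubC //= ?ifT //; lia. Qed.

Lemma horner_in_qpoly (p : {poly C}) (i : 'I_N) :
  (in_qpoly ('X^N - 1) p : {poly C}).[w ^+ i] = p.[w ^+ i].
Proof.
rewrite /= mk_monic_XnsubC.
have h_monic : 'X^N - 1 \is @monic C by apply: monicXnsubC; lia.
rewrite [in RHS](Pdiv.RingMonic.rdivp_eq h_monic p).
by rewrite !hornerE -exprM mulnC exprM wN expr1n subrr mulr0 add0r.
Qed.

(** A representative has degree below N, so it is zero once it vanishes at the N distinct points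
    omega^i. *)
Lemma cyc_val_inj f g : (forall i, cyc_val i f = cyc_val i g) -> f = g.
Proof.
move=> fg; apply/eqP; rewrite -subr_eq0; apply/eqP/val_inj.
apply: (@roots_geq_poly_eq0 _ _ [seq w ^+ (i : 'I_N) | i <- enum 'I_N]).
- apply/allP => _ /mapP[i _ ->]; rewrite rootE hornerD hornerN.
  by rewrite -!/(cyc_val i _) fg subrr.
- rewrite map_inj_uniq ?enum_uniq // => i j /eqP.
  by rewrite (eq_prim_root_expr w_prim) !modn_small // => /eqP/val_inj.
rewrite size_map size_enum_ord -ltnS.
apply: leq_trans (size_mk_monic (f - g)) _.
by rewrite mk_monic_XnsubC size_XnsubC //; lia.
Qed.

Lemma cyc_valM i f g : cyc_val i (f * g) = cyc_val i f * cyc_val i g.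
Proof. by rewrite /cyc_val horner_in_qpoly hornerM. Qed.

Lemma cyc_valX i f m : cyc_val i (f ^+ m) = cyc_val i f ^+ m.
Proof.
by elim: m => [|m IHm]; rewrite ?cyc_val1 // !exprS cyc_valM IHm.
Qed.

Lemma cyc_valV i f : (forall j, cyc_val j f != 0) ->
  cyc_val i f^-1 = (cyc_val i f)^-1.
Proof.
move=> f_neq0.
suff f_unit : f \is a GRing.unit.
  by apply: (mulfI (f_neq0 i)); rewrite -cyc_valM divrr // cyc_val1 divff.
(* Units of the quotient are by definition the classes coprime to the modulus, which splits into the
   factors ['X - w^j]. *)
change (coprimep (mk_monic ('X^N - 1)) f).
have: forall j : 'I_N, (f : {poly C}).[w ^+ j] != 0 by exact: f_neq0.
move: (f : {poly C}) => p {}f_neq0.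
rewrite mk_monic_XnsubC -(factor_Xn_sub_1 w_prim) big_mkord.
apply: (big_ind (fun q => coprimep q p)) => [|q q' qp q'p|j _].
- exact: coprime1p.
- by rewrite coprimepMl qp.
- by rewrite coprimep_sym coprimep_XsubC rootE f_neq0.
Qed.

Lemma cyc_val_z i : cyc_val i (cyc_z R N) = w ^+ i.
Proof. by rewrite /cyc_val horner_in_qpoly hornerX. Qed.

Lemma cyc_val_zV i : cyc_val i (cyc_z R N)^-1 = (w ^+ i)^-1.
Proof.
rewrite cyc_valV => [|j]; first by rewrite cyc_val_z.
by rewrite cyc_val_z expf_neq0.
Qed.

Lemma cyc_val_a i : cyc_val i (cyc_a N u) = node i - (node i)^-1.
Proof. by rewrite cyc_valB !cyc_valZ cyc_val_z cyc_val_zV /node invfM. Qed.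

Lemma cyc_val_x i : cyc_val i (cyc_x N u) = node i + (node i)^-1.
Proof. by rewrite cyc_valD !cyc_valZ cyc_val_z cyc_val_zV /node invfM. Qed.

Lemma cyc_col_t f : cyc_col (cyc_t f) = t_mx R N *m cyc_col f.
Proof.
apply/colP => i; rewrite t_mx_col !mxE /cyc_val horner_in_qpoly horner_comp.
by rewrite !hornerE /= (prim_expr_mod w_prim) exprS.
Qed.

Lemma cyc_col_tV f : cyc_col (cyc_tV f) = invmx (t_mx R N) *m cyc_col f.
Proof.
suff -> : cyc_col f = t_mx R N *m cyc_col (cyc_tV f).
  by rewrite mulKmx ?t_mx_unit.
apply/colP => i; rewrite t_mx_col !mxE /cyc_val horner_in_qpoly horner_comp.
by rewrite !hornerE /= (prim_expr_mod w_prim) exprS mulKf.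
Qed.

Lemma cyc_col_tz k f : cyc_col (cyc_tz k f) = mxpowz (t_mx R N) k *m cyc_col f.
Proof.
case: k => p; [rewrite /= | rewrite /cyc_tz /mxpowz; move: p.+1 => {}p].
  elim: p => [|p IHp]; first by rewrite expr0 mul1mx.
  by rewrite iterS cyc_col_t IHp exprS -mulmxE mulmxA.
elim: p => [|p IHp]; first by rewrite expr0 mul1mx.
by rewrite iterS cyc_col_tV IHp exprS -mulmxE mulmxA.
Qed.

(** * Even N: vanishing of C_N(k) *)

Variable n : nat.
Hypothesis hNn : N = (2 * n)%N.

Let n_gt0 : (0 < n)%N.
Proof. by move: N_gt0; rewrite hNn muln_gt0. Qed.

Lemma omega_half : w ^+ n = - 1.
Proof.
have : (w ^+ n) ^+ 2 == 1 by rewrite -exprM mulnC -hNn wN.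
rewrite sqrf_eq1 => /orP[|/eqP //].
by rewrite -(prim_order_dvd w_prim) => /dvdn_leq; lia.
Qed.

(** Equality of omega^m and omega^-m means omega^{2m} = 1, that is, 2n divides 2m. *)
Lemma omega_sub_eq0 m : (omega_sub m == 0) = (n%:Z %| m)%Z.
Proof.
rewrite /omega_sub subr_eq0 -(inj_eq (mulfI (expfz_neq0 m w_neq0))).
rewrite -!expfzDr //.
rewrite subrr expr0z omega_expz_eq1 hNn PoszM -mulr2n -mulr_natl.
by rewrite dvdz_mul2l.
Qed.

Lemma C_prod_neq0 (k : 'I_n.-1 -> int) :
  (C_prod R N k != 0) = [forall i : 'I_n.-1, ~~ (n%:Z %| i.+1%:Z * k i)%Z].
Proof.
apply/idP/forallP => [/prodf_neq0 C_neq0 i|dvd_n].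
  by rewrite -omega_sub_eq0; apply: C_neq0.
by apply/prodf_neq0 => i _; have := dvd_n i; rewrite -omega_sub_eq0.
Qed.

(** * Laurent monomials in y and Chebyshev identities *)

Hypothesis hu0 : u != 0.

Lemma node_neq0 i : node i != 0.
Proof. by rewrite mulf_neq0 // expf_neq0. Qed.

Lemma monom_shift m : monom (m + N%:Z) = u ^+ N *: monom m.
Proof.
apply/colP => i; rewrite !mxE expfzDr ?node_neq0 // mulrC.
by rewrite -exprnP nodeXN.
Qed.

Lemma a_mxE : a_mx N u = diag_mx (\row_i (node i - (node i)^-1)).
Proof.
have -> : a_mx N u = u *: d_mx R N - u^-1 *: diag_mx (\row_i (w ^+ i)^-1).
  rewrite /a_mx; congr (_ - _ *: _); apply: invmx_eq; rewrite mulmx_diag.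
  by apply/matrixP => i j; rewrite !mxE divff ?expf_neq0.
by apply/matrixP => i j; rewrite !mxE /node invfM !mulrnAr -mulrnBl.
Qed.

Lemma a_mx_monom m : a_mx N u *m monom m = monom (m + 1) - monom (m - 1).
Proof.
apply/colP => i; rewrite a_mxE mul_diag_mx !mxE.
by rewrite !expfzDr ?node_neq0 // expr1z exprN1 mulrBl ![_ * node i ^ m]mulrC.
Qed.

(** Telescoping: this is (y - y^-1) U_m(y + y^-1) = y^{m+1} - y^{-m-1}, times y^e. *)
Lemma a_mx_cheb e m :
  a_mx N u *m cheb e m = monom (e + m.+1%:Z) - monom (e - m.+1%:Z).
Proof.
rewrite mulmx_sumr.
pose f j := - monom (e + m.+1%:Z - 2 * j%:Z).
rewrite -(big_mkord xpredT (fun i => a_mx N u *m monom (e + m%:Z - 2 * i%:Z))).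
rewrite (telescope_sumr_eq f) // => [|i _]; rewrite /f opprK.
  by rewrite addrC; congr (monom _ - monom _); lia.
by rewrite a_mx_monom [RHS]addrC; congr (monom _ - monom _); lia.
Qed.

Lemma x_mx_monom m : x_mx *m monom m = monom (m + 1) + monom (m - 1).
Proof.
apply/colP => i; rewrite mul_diag_mx !mxE.
by rewrite !expfzDr ?node_neq0 // expr1z exprN1 mulrDl ![_ * node i ^ m]mulrC.
Qed.

Lemma x_mx_cheb0 (e : int) : x_mx *m cheb e 0 = cheb e 1.
Proof. by rewrite cheb0 cheb1 x_mx_monom. Qed.

Lemma x_mx_chebS (e : int) m : x_mx *m cheb e m.+1 = cheb e m.+2 + cheb e m.
Proof.
rewrite /cheb mulmx_sumr (eq_bigr _ (fun i _ => x_mx_monom _)) big_split /=.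
rewrite [in RHS]big_ord_recr [X in _ + X]big_ord_recr /= -addrA addrA.
rewrite -[RHS]addrA; congr (_ + _).
  by apply: eq_bigr => i _; congr monom; lia.
rewrite addrC; congr (monom _ + _); first by lia.
by apply: eq_bigr => i _; congr monom; lia.
Qed.

(** x^m and U_m(x) differ by lower-degree terms, which [M] kills. [M] is arbitrary so that the
    induction can pass to [M *m x_mx]. *)
Lemma x_mx_lower m p (M : 'M[C]_(p, N)) :
  (forall j, (j < m)%N -> M *m cheb 0 j = 0) ->
  M *m (\col_i (node i + (node i)^-1) ^+ m) = M *m cheb 0 m.
Proof.
elim: m p M => [|m IHm] p M killM.
  by rewrite cheb0; congr (_ *m _); apply/colP => i; rewrite !mxE.
have -> : \col_i (node i + (node i)^-1) ^+ m.+1 =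
    x_mx *m \col_i (node i + (node i)^-1) ^+ m.
  by apply/colP => i; rewrite mul_diag_mx !mxE exprS.
rewrite mulmxA IHm => [|[|j] jm]; rewrite -mulmxA.
- case: m killM {IHm} => [|m] killM; first by rewrite x_mx_cheb0.
  by rewrite x_mx_chebS mulmxDr (killM m) ?addr0.
- by rewrite x_mx_cheb0 killM.
- by rewrite x_mx_chebS mulmxDr !killM ?addr0 //; lia.
Qed.

(** Inverse discrete Fourier transform: the ratio of two distinct nodes is an N-th root of unity
    other than 1, so its geometric sum vanishes. *)
Lemma delta_monom (i : 'I_N) : delta_mx i 0 =
  \sum_(m < N) (N%:R^-1 * node i ^ (- m%:Z)) *: monom m%:Z.
Proof.
have N_neq0 : N%:R != 0 :> C by rewrite pnatr_eq0; lia.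
apply/colP => j; rewrite summxE !mxE eqxx andbT.
pose z := node j / node i.
rewrite (eq_bigr (fun m : 'I_N => N%:R^-1 * z ^+ m)) => [|m _]; last first.
  by rewrite !mxE -mulrA mulrCA mulrC -mulrA -invr_expz -!exprnP -expr_div_n.
rewrite -mulr_sumr; case: (eqVneq j i) => [ji|ji].
  rewrite /z ji divff ?node_neq0 // (eq_bigr (fun=> 1)) => [|m _].
    by rewrite sumr_const card_ord mulVf.
  by rewrite expr1n.
have z_neq1 : z - 1 != 0.
  apply: contra ji; rewrite subr_eq0 => /eqP zE.
  have /(mulfI hu0)/eqP : node j = node i.
    by rewrite -[RHS]mul1r -zE divfK ?node_neq0.
  by rewrite (eq_prim_root_expr w_prim) !modn_small.
suff /eqP : (z - 1) * \sum_(m < N) z ^+ m = 0.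
  by rewrite mulf_eq0 (negPf z_neq1) => /= /eqP ->; rewrite mulr0.
by rewrite -subrX1 expr_div_n !nodeXN divff ?subrr // expf_neq0.
Qed.

(** * Invertibility of a, and the action of B_k on the chains *)

Hypothesis huN : u ^+ N != 1.

(** If y = y^-1 at a node, then y^2 = 1 there and, N being even, u^N = y^N = 1. *)
Lemma node_subV_neq0 i : node i - (node i)^-1 != 0.
Proof.
apply: contraNneq huN => /eqP; rewrite subr_eq0 => /eqP nodeE.
have : node i ^+ 2 = 1 by rewrite expr2 {1}nodeE mulVf ?node_neq0.
by rewrite -(nodeXN i) hNn exprM => ->; rewrite expr1n.
Qed.

Lemma s_mxE : s_mx N u = diag_mx (\row_i (node i - (node i)^-1)^-1).
Proof.
rewrite /s_mx a_mxE; apply: invmx_eq; rewrite mulmx_diag.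
by apply/matrixP => i j; rewrite !mxE divff ?node_subV_neq0.
Qed.

Lemma a_mx_unit : a_mx N u \in unitmx.
Proof.
rewrite a_mxE unitmxE det_diag unitfE; apply/prodf_neq0 => i _.
by rewrite mxE node_subV_neq0.
Qed.

Lemma s_mx_unit : s_mx N u \in unitmx.
Proof. by rewrite unitmx_inv a_mx_unit. Qed.

(** Since omega^{ke} = omega^{-ke}, t^k - t^-k scales the two monomials by opposite scalars. The
    outcome is a multiple of their difference, which is a applied to [cheb e m], and s cancels a. *)
Lemma B_mx_sym k (e : int) m : w ^ (2 * e) = 1 ->
  B_mx N u k *m (monom (e + m.+1%:Z) + monom (e - m.+1%:Z)) =
  (w ^ (k * e) * omega_sub (m.+1%:Z * k)) *: cheb e m.
Proof.
move=> w2e; have wke : w ^ (- (k * e)) = w ^ (k * e).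
  have : w ^ (k * e) * w ^ (k * e) = 1.
    rewrite -expfzDr // -mulr2n -mulr_natl mulrCA mulrC -exprz_exp w2e.
    exact: exp1rz.
  by move=> wke2; rewrite -invr_expz -[LHS]mulr1 -wke2 mulKf ?expfz_neq0.
rewrite mulmxDr !B_mx_monom.
have -> : omega_sub (k * (e + m.+1%:Z)) = w ^ (k * e) * omega_sub (m.+1%:Z * k).
  rewrite /omega_sub mulrDr opprD !expfzDr // wke -mulrBr.
  by rewrite [k * m.+1%:Z]mulrC.
have -> : omega_sub (k * (e - m.+1%:Z)) =
    - (w ^ (k * e) * omega_sub (m.+1%:Z * k)).
  rewrite /omega_sub mulrBr opprD !expfzDr // wke -mulrBr opprK.
  by rewrite [k * m.+1%:Z]mulrC -[RHS]mulrN opprB.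
rewrite scaleNr -scalerBr -mulmxBr -a_mx_cheb; congr (_ *: _).
by rewrite mulKmx // a_mx_unit.
Qed.

(** Split U_{m+1} = U_{m-1} + (y^{m+1} + y^{-m-1}): the symmetric pair yields exactly the leading
    term by [B_mx_sym], and strong induction handles U_{m-1}. *)
Lemma B_mx_chebS k (e : int) m : w ^ (2 * e) = 1 ->
  lower e m (B_mx N u k *m cheb e m.+1 -
             (w ^ (k * e) * omega_sub (m.+1%:Z * k)) *: cheb e m).
Proof.
move=> w2e; elim/ltn_ind: m => -[|m] IHm p M killM.
  by rewrite cheb1 (B_mx_sym k 0 w2e) subrr mulmx0.
rewrite chebSS [B_mx N u k *m (_ + _)]mulmxDr B_mx_sym // addrK.
case: m IHm killM => [|m] IHm killM; first by rewrite B_mx_cheb0 // mulmx0.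
have /(_ p M) := IHm m (ltnW (ltnSn m.+1)).
rewrite mulmxBr -scalemxAr killM // scaler0 subr0; apply => j jm.
by apply: killM; lia.
Qed.

(** The last factor acts first: it takes degree j+1 to degree j modulo terms that the remaining word
    kills. On the top degree it contributes the last factor of [C_prod], times a power of omega. *)
Lemma reduced_word_cheb m (k : 'I_m -> int) (e : int) : w ^ (2 * e) = 1 ->
  (forall j, (j < m)%N -> reduced_word N u k *m cheb e j = 0) /\
  reduced_word N u k *m cheb e m =
    ((\prod_(i < m) w ^ (k i * e)) * C_prod R N k) *: monom e.
Proof.
move=> w2e; elim: m k => [|m IHm] k.
  split=> //.
  by rewrite /C_prod /reduced_word !big_ord0 mul1mx mulr1 scale1r cheb0.
have [kill top] := IHm (fun i => k (widen_ord (leqnSn m) i)).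
rewrite reduced_word_recr; move: kill top.
set W := reduced_word N u _ => kill top.
have step j : (j <= m)%N -> W *m B_mx N u (k ord_max) *m cheb e j.+1 =
  (w ^ (k ord_max * e) * omega_sub (j.+1%:Z * k ord_max)) *: (W *m cheb e j).
  move=> jm; have := @B_mx_chebS (k ord_max) e j w2e _ W.
  rewrite mulmxBr -scalemxAr mulmxA => W_lower.
  by apply/eqP; rewrite -subr_eq0 W_lower // => i ij; apply: kill; lia.
split=> [[|j] jm|].
- by rewrite -mulmxA B_mx_cheb0 // mulmx0.
- by rewrite step 1?ltnW // kill // scaler0.
rewrite step // top scalerA /C_prod !big_ord_recr /=; congr (_ *: _).
by rewrite [RHS]mulrACA mulrC.
Qed.

(* As y^N = u^N, multiplying y^j + y^-j by y^n gives y^m + u^N y^-m with      *)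
(* m = n - j, which together with y^m + y^-m recovers y^m since u^N <> 1.     *)
Lemma cheb_span (P : 'cV[C]_N -> Prop) :
    (forall v v', P v -> P v' -> P (v + v')) ->
    (forall c v, P v -> P (c *: v)) ->
    (forall j, (j < n)%N -> P (cheb 0 j)) ->
    (forall j, (j < n)%N -> P (cheb n%:Z j)) ->
  forall v, P v.
Proof.
move=> PD PZ P0 Pn.
have PB v v' : P v -> P v' -> P (v - v').
  by move=> Pv Pv'; rewrite -scaleN1r; apply: PD => //; apply: PZ.
have Psym (e : int) m : (forall j, (j < n)%N -> P (cheb e j)) -> (m < n)%N ->
    P (monom (e + m%:Z) + monom (e - m%:Z)).
  move=> Pe; case: m => [|[|m]] mn.
  - by rewrite !addr0 -cheb0; apply: PD; apply: Pe.
  - by rewrite -cheb1; apply: Pe.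
  have := PB _ _ (Pe _ mn) (Pe m (ltnW (ltnW mn))).
  by rewrite chebSS addrC addKr.
have PmonomN m : (0 < m < n)%N -> P (monom (- m%:Z)).
  move=> /andP[m_gt0 mn].
  have := PB _ _ (Psym n%:Z (n - m)%N Pn _) (Psym 0 m P0 mn).
  have -> : n%:Z + (n - m)%N%:Z = - m%:Z + N%:Z by lia.
  have -> : n%:Z - (n - m)%N%:Z = m%:Z by lia.
  rewrite monom_shift add0r sub0r addrKA -{2}[monom _]scale1r -scalerBl.
  rewrite ltn_subrL m_gt0 n_gt0 => /(_ isT).
  by move=> /(PZ (u ^+ N - 1)^-1); rewrite scalerA mulVf ?scale1r // subr_eq0.
have Pmonom (m : 'I_N) : P (monom m%:Z).
  have := ltn_ord m; case: (ltngtP m n) => [mn _|mn mN|-> _].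
  - case: (posnP m) => [->|m_gt0]; first by rewrite -cheb0; apply: P0.
    have := PB _ _ (Psym 0 m P0 mn) (PmonomN m _).
    by rewrite m_gt0 mn add0r sub0r addrK; apply.
  - have -> : m%:Z = - (N - m)%N%:Z + N%:Z by lia.
    by rewrite monom_shift; apply: PZ; apply: PmonomN; lia.
  - by rewrite -cheb0; apply: Pn.
have P00 : P 0 by rewrite -(scale0r (cheb 0 0)); apply: PZ; apply: P0.
move=> v; rewrite [v]matrix_sum_delta; apply: big_ind => // i _.
by rewrite big_ord1 delta_monom; apply/PZ; apply: big_ind => // m _; apply: PZ.
Qed.

(** * Rank of the words *)

Lemma monom_free : row_free (col_mx (monom 0)^T (monom n%:Z)^T).
Proof.
apply: inj_row_free => v.
rewrite -[v]hsubmxK mul_row_col.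
set p := lsubmx v; set q := rsubmx v.
rewrite [p]mx11_scalar [q]mx11_scalar !mul_scalar_mx.
move=> /rowP pq0.
(* As omega^n = -1, y^n takes the value u^n (-1)^i at node i, so the coordinates 0 and 1 already
   separate it from the constant 1. *)
have pqE (i : 'I_N) : p 0 0 + q 0 0 * (u ^+ n * (- 1) ^+ i) = 0.
  have := pq0 i; rewrite !mxE expr0z mulr1 -exprnP /node exprMn exprAC.
  by rewrite omega_half.
have N_gt1 : (1 < N)%N by lia.
have := pqE (Ordinal (ltnW N_gt1)); have := pqE (Ordinal N_gt1).
rewrite /= expr0 expr1 !mulr1 mulrN1 mulrN => pq1 pq.
have p0 : p 0 0 = 0.
  have : p 0 0 *+ 2 = p 0 0 + q 0 0 * u ^+ n + (p 0 0 - q 0 0 * u ^+ n) by ring.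
  by rewrite pq pq1 addr0 => /eqP; rewrite mulrn_eq0 => /eqP.
have q0 : q 0 0 = 0.
  move: pq; rewrite p0 add0r => /eqP; rewrite mulf_eq0 expf_eq0 (negPf hu0).
  by rewrite andbF orbF => /eqP.
by rewrite p0 q0 !raddf0 row_mx0.
Qed.

(** By [cheb_span] the image of [M] is spanned by [c0 *: monom 0] and [cn *: monom n%:Z]; the
    coefficients vanish together, so rank 1 cannot occur. *)
Lemma mxrank_two_chains (M : 'M[C]_N) (c0 cn : C) :
    (forall j, (j < n.-1)%N -> M *m cheb 0 j = 0) ->
    (forall j, (j < n.-1)%N -> M *m cheb n%:Z j = 0) ->
    M *m cheb 0 n.-1 = c0 *: monom 0 ->
    M *m cheb n%:Z n.-1 = cn *: monom n%:Z ->
    (c0 == 0) = (cn == 0) ->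
  \rank M = (2 * (c0 != 0)%R)%N.
Proof.
move=> kill0 killn top0 topn c0n.
have ltnE j : (j < n)%N = (j == n.-1) || (j < n.-1)%N.
  by apply/idP/idP; lia.
move: c0n; case: (eqVneq c0 0) => c0E c0n.
  apply/eqP; rewrite mxrank_eq0; apply/eqP.
  have M0 (v : 'cV_N) : M *m v = 0.
    apply: (cheb_span (P := fun v => M *m v = 0)).
    - by move=> v1 v2 M1 M2; rewrite mulmxDr M1 M2 addr0.
    - by move=> c v1 M1; rewrite -scalemxAr M1 scaler0.
    - move=> j; rewrite ltnE => /orP[/eqP ->|/kill0 //].
      by rewrite top0 c0E scale0r.
    - move=> j; rewrite ltnE => /orP[/eqP ->|/killn //].
      by rewrite topn (eqP (esym c0n)) scale0r.
  apply/matrixP => i j; have /colP/(_ i) := M0 (delta_mx j 0).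
  by rewrite -colE !mxE.
have cn0 : cn != 0 by rewrite -c0n.
set G := col_mx (monom 0)^T (monom n%:Z)^T.
have -> : (2 * true)%N = \rank G by rewrite (eqP monom_free).
(* Transposing turns the image of [M] into a row space, to be compared with that of [G]. *)
rewrite -mxrank_tr; apply: eqmx_rank; apply/andP; split.
  have MG (v : 'cV_N) : ((M *m v)^T <= G)%MS.
    apply: (cheb_span (P := fun v => ((M *m v)^T <= G)%MS)).
    - by move=> v1 v2 M1 M2; rewrite mulmxDr linearD addmx_sub.
    - by move=> c v1 M1; rewrite -scalemxAr linearZ scalemx_sub.
    - move=> j; rewrite ltnE => /orP[/eqP ->|/kill0 ->]; last first.
        by rewrite trmx0 sub0mx.
      by rewrite top0 linearZ scalemx_sub // -addsmxE addsmxSl.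
    - move=> j; rewrite ltnE => /orP[/eqP ->|/killn ->]; last first.
        by rewrite trmx0 sub0mx.
      by rewrite topn linearZ scalemx_sub // -addsmxE addsmxSr.
  by apply/row_subP => i; rewrite -tr_col colE.
rewrite col_mx_sub; apply/andP; split.
  rewrite -[monom 0]scale1r -(mulVf c0E) -scalerA -top0 linearZ /=.
  by rewrite trmx_mul scalemx_sub // submxMl.
rewrite -[monom n%:Z]scale1r -(mulVf cn0) -scalerA -topn linearZ /=.
by rewrite trmx_mul scalemx_sub // submxMl.
Qed.

(** On either chain the top coefficient is C_N(k) times a power of omega, so the two coefficients
    vanish together. *)
Lemma mxrank_word_C (k : 'I_n.-1 -> int) :
  \rank (word N k u) = (2 * (C_prod R N k != 0)%R)%N.
Proof.
have w0 : w ^ (2 * 0 : int) = 1 by rewrite mulr0 expr0z.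
have wn : w ^ (2 * n%:Z) = 1 by rewrite -PoszM -hNn -exprnP wN.
have [kill0 top0] := reduced_word_cheb k w0.
have [killn topn] := reduced_word_cheb k wn.
have prod_neq0 (e : int) : \prod_(i < n.-1) w ^ (k i * e) != 0.
  by apply/prodf_neq0 => i _; apply: expfz_neq0.
rewrite mxrank_word ?s_mx_unit // (mxrank_two_chains kill0 killn top0 topn).
  by rewrite mulf_eq0 negb_or prod_neq0.
by rewrite !mulf_eq0 !(negPf (prod_neq0 _)).
Qed.

(** * Transport to the cyclic model and the vector v_N *)

Lemma cyc_col_s f : cyc_col (cyc_s u f) = s_mx N u *m cyc_col f.
Proof.
apply/colP => i; rewrite s_mxE mul_diag_mx !mxE cyc_valM cyc_valV ?cyc_val_a //.
by move=> j; rewrite cyc_val_a node_subV_neq0.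
Qed.

Lemma cyc_col_B k f : cyc_col (cyc_B u k f) = B_mx N u k *m cyc_col f.
Proof.
rewrite /cyc_B cyc_col_s /B_mx -mulmxA mulmxBl -!cyc_col_tz; congr (_ *m _).
by apply/colP => i; rewrite !mxE cyc_valB.
Qed.

Lemma cyc_col_reduced_word m (k : 'I_m -> int) f :
  cyc_col ((\big[comp/id]_(i < m) cyc_B u (k i)) f) =
  reduced_word N u k *m cyc_col f.
Proof.
rewrite /reduced_word; elim: (index_enum _) => [|i r IHr].
  by rewrite !big_nil mul1mx.
by rewrite !big_cons /= cyc_col_B IHr -mulmxE mulmxA.
Qed.

Lemma cyc_B_x (k : 'I_n.-1 -> int) :
  (\big[comp/id]_(i < n.-1) cyc_B u (k i))
    (cyc_s u (cyc_a N u * cyc_x N u ^+ n.-1)) = C_prod R N k *: 1.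
Proof.
have w0 : w ^ (2 * 0 : int) = 1 by rewrite mulr0 expr0z.
have [kill0 top0] := reduced_word_cheb k w0.
have Wx : reduced_word N u k *m (\col_i (node i + (node i)^-1) ^+ n.-1) =
    C_prod R N k *: monom 0.
  (* The word kills the terms by which x^{n-1} differs from U_{n-1}(x); for e = 0 the powers of
     omega in the coefficient are 1. *)
  rewrite x_mx_lower // top0 big1 ?mul1r // => i _.
  by rewrite mulr0 expr0z.
apply: cyc_val_inj => i.
have /colP/(_ i) := cyc_col_reduced_word k
  (cyc_s u (cyc_a N u * cyc_x N u ^+ n.-1)).
rewrite [LHS]mxE => ->; rewrite cyc_col_s.
have -> : s_mx N u *m cyc_col (cyc_a N u * cyc_x N u ^+ n.-1) =
    \col_i (node i + (node i)^-1) ^+ n.-1.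
  apply/colP => j; rewrite s_mxE mul_diag_mx !mxE cyc_valM cyc_valX.
  by rewrite cyc_val_a cyc_val_x mulKf ?node_subV_neq0.
by rewrite Wx !mxE cyc_valZ cyc_val1.
Qed.

Lemma word_neq0 (k : 'I_n.-1 -> int) :
  (word N k u != 0) = (C_prod R N k != 0).
Proof. by rewrite -mxrank_eq0 mxrank_word_C muln_eq0 eqb0 negbK. Qed.

End LaurentBasis.

(** * Counting exponent tuples *)

Lemma card_ord_dvdn d m : (0 < d)%N -> (d %| m)%N ->
  #|[pred x : 'I_m | (d %| x)%N]| = (m %/ d)%N.
Proof.
move=> d_gt0 dm; rewrite -sum1_card big_mkcond /=.
rewrite (eq_bigr (fun x : 'I_m => nat_of_bool (d %| x)%N)); last first.
  by move=> x _; rewrite inE; case: (d %| x)%N.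
rewrite -(big_mkord xpredT (fun x => nat_of_bool (d %| x)%N)) divn_count_dvd.
(* [divn_count_dvd] counts over 1..m while ['I_m] is 0..m-1; 0 and m are exchanged, both being
   multiples of d. *)
case: m dm => [|m] dm; first by rewrite !big_nil.
by rewrite big_ltn // [RHS]big_nat_recr //= dvdn0 dm addnC.
Qed.

(** With g = gcd(j, n), n divides jx exactly when n/g divides x, and 2g of the 2n residues are
    multiples of n/g. *)
Lemma card_ord_ndvd_mul n j : (0 < n)%N ->
  #|[pred x : 'I_(2 * n) | ~~ (n %| j * x)%N]| = (2 * (n - gcdn j n))%N.
Proof.
move=> n_gt0; set g := gcdn j n.
have g_gt0 : (0 < g)%N by rewrite gcdn_gt0 n_gt0 orbT.
have gn : (g %| n)%N by apply: dvdn_gcdr.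
have dvdE (x : nat) : (n %| j * x)%N = (n %/ g %| x)%N.
  rewrite dvdn_divLR // muln_gcdr dvdn_gcd [(n %| x * n)%N]dvdn_mull //.
  by rewrite andbT mulnC.
move: g g_gt0 gn dvdE => g g_gt0 gn dvdE.
rewrite mulnBr -[X in (X - _)%N](card_ord (2 * n)).
rewrite -(cardC [pred x : 'I_(2 * n) | (n %/ g %| x)%N]) card_ord_dvdn.
- have -> : (2 * n %/ (n %/ g) = 2 * g)%N.
    have {1}-> : (2 * n = 2 * g * (n %/ g))%N.
      by rewrite -mulnA [(g * _)%N]mulnC divnK.
    by rewrite mulnK // divn_gt0 // dvdn_leq.
  by rewrite addKn; apply: eq_card => x; rewrite !inE dvdE.
- by rewrite divn_gt0 // dvdn_leq.
by apply: dvdn_mull; rewrite dvdn_divLR // dvdn_mulr.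
Qed.

Theorem proposition5p2 (R : realType) (N n : nat) (u : R[i])
    (hNn : N = (2 * n)%N) (hN : (4 <= N)%N) (hu0 : u != 0) (huN : u ^+ N != 1) :
  (forall k : 'I_n.-1 -> int,
     [/\ (word N k u != 0 <-> C_prod R N k != 0),
         (C_prod R N k != 0 <->
          forall i : 'I_n.-1, ~~ (n%:Z %| i.+1%:Z * k i)%Z),
         (word N k u != 0 -> \rank (word N k u) = 2%N) &
         (\big[comp/id]_(i < n.-1) cyc_B u (k i))
           (cyc_s u (cyc_a N u * cyc_x N u ^+ n.-1)) =
         C_prod R N k *: 1])
  /\ #|[set k : {ffun 'I_n.-1 -> 'I_N} |
        word N (fun i => (k i : nat)%:Z) u != 0]|
     = (2 ^ n.-1 * \prod_(1 <= j < n) (n - gcdn j n))%N.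
Proof.
have n_gt0 : (0 < n)%N by lia.
have N_gt0 : (0 < N)%N by lia.
have word_C := word_neq0 N_gt0 hNn hu0 huN.
have C_dvd := C_prod_neq0 R N_gt0 hNn.
split=> [k|].
  split.
  - by rewrite word_C.
  - by rewrite C_dvd; split=> /forallP.
  - by rewrite word_C (mxrank_word_C N_gt0 hNn hu0 huN) => ->.
  - exact: (cyc_B_x N_gt0 hNn hu0 huN).
(* Nonvanishing constrains each exponent separately, so the tuples form a product of finite sets. *)
pose F (i : 'I_n.-1) := [pred x : 'I_N | ~~ (n %| i.+1 * x)%N].
transitivity #|family F|.
  apply: eq_card => k; rewrite !inE word_C C_dvd.
  apply/forallP/forallP => k_ndvd i; have := k_ndvd i.
    by rewrite inE -PoszM dvdzE.
  by rewrite inE -PoszM dvdzE.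
rewrite card_family foldrE big_map big_enum /= /F.
rewrite (eq_bigr (fun i : 'I_n.-1 => 2 * (n - gcdn i.+1 n))%N) => [|i _].
  rewrite big_split /= prod_nat_const card_ord big_add1; congr (_ * _)%N.
  by rewrite big_mkord.
by rewrite -card_ord_ndvd_mul // -hNn.
Qed.
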